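(* Let $k\ge2$ and $d\ge0$. In the sequence of inclusions of $\mathbb{Z}_k$-spaces $$(\mathbb{Z}_k)^{*(d+1)}=(\mathbb{Z}_k)^{*(d+1)}_{\mathrm{alt}\le d}\subset(\mathbb{Z}_k)^{*(d+2)}_{\mathrm{alt}\le d}\subset\cdots\subset(\mathbb{Z}_k)^{*m}_{\mathrm{alt}\le d}\subset\cdots\subset(\mathbb{Z}_k)^{*\mathbb{N}}_{\mathrm{alt}\le d}=\bigcup_{m\ge d+1}(\mathbb{Z}_k)^{*m}_{\mathrm{alt}\le d},$$ all the inclusions are strong deformation retracts (i.e. each space is a strong deformation retract of each of the larger ones containing it).
   Context: $\mathbb{Z}_k$ is the cyclic group of order $k$, regarded as a discrete set of $k$ points. The join $(\mathbb{Z}_k)^{*m}$ is the simplicial complex with vertex set $\mathbb{Z}_k\times\{1,\dots,m\}$ whose simplices are the sets of vertices containing at most one vertex from each copy $\mathbb{Z}_k\times\{j\}$; its facets are denoted $\langle i_1,\dots,i_m\rangle$ ($i_j\in\mathbb{Z}_k$ being the vertex in the $j$-th copy). The group $\mathbb{Z}_k$ acts on it diagonally by translation. $(\mathbb{Z}_k)^{*m}$ is viewed as a subcomplex of $(\mathbb{Z}_k)^{*(m+1)}$ via the first $m$ copies. For $d\ge0$ and $m\ge d+1$, $(\mathbb{Z}_k)^{*m}_{\mathrm{alt}\le d}$ is the subcomplex of $(\mathbb{Z}_k)^{*m}$ whose facets are all simplices $\langle i_1,\dots,i_m\rangle$ with at most $d$ jumps, i.e. with $\#\{j\in\{1,\dots,m-1\}: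 i_j\ne i_{j+1}\}\le d$. Simplicial complexes are identified with their geometric realizations (with the usual weak topology for infinite complexes). *)

(* Defs.v *)
From HB Require Import structures.
From mathcomp Require Import all_boot all_order all_algebra finmap.
From mathcomp Require Import all_classical all_reals all_analysis.

Set Implicit Arguments.
Unset Strict Implicit.
Unset Printing Implicit Defensive.

Import Order.TTheory GRing.Theory Num.Theory.
Import numFieldNormedType.Exports.

Local Open Scope classical_set_scope.
Local Open Scope ring_scope.

(* Abstract simplicial complexes.  The empty simplex is allowed; it does not
   contribute to the geometric realization. *)
Record complex (V : choiceType) := Complex {
  faces : set {fset V};
  faces_sub : forall s t : {fset V}, (t `<=` s)%fset -> faces s -> faces t }.

(* Barycentric coordinates of the points of the realization of K. *)
Definition is_point (R : realType) (V : choiceType) (K : complex V)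
    (x : {fsfun V -> R with 0}) : Prop :=
  [/\ forall v, 0 <= x v, \sum_(v <- finsupp x) x v = 1 & faces K (finsupp x)].

Record geom (R : realType) (V : choiceType) (K : complex V) := Geom {
  bary : {fsfun V -> R with 0};
  _ : `[< is_point K bary >] }.

HB.instance Definition _ R V K := [isSub for @bary R V K].
HB.instance Definition _ R V K := [Choice of @geom R V K by <:].

Lemma geomP (R : realType) (V : choiceType) (K : complex V) (x : geom R K) :
  is_point K (bary x).
Proof. by case: x => x px /=; apply/asboolP. Qed.

Definition closed_simplex (R : realType) (V : choiceType) (K : complex V)
    (s : {fset V}) : set (geom R K) :=
  [set x | (finsupp (bary x) `<=` s)%fset].
Arguments closed_simplex R {V} K s.

(* The weak topology: U is open when its trace on every closed simplex s of K
   is open for the Euclidean topology of s, here given by the sup distance of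
   the (finitely many) barycentric coordinates indexed by s. *)
Definition weak_open (R : realType) (V : choiceType) (K : complex V)
    (U : set (geom R K)) : Prop :=
  forall s : {fset V}, faces K s ->
  forall x, closed_simplex R K s x -> U x ->
  exists2 e : R, 0 < e &
    forall y, closed_simplex R K s y ->
      (forall v, v \in s -> `|bary x v - bary y v| < e) -> U y.

Section WeakTopology.
Variables (R : realType) (V : choiceType) (K : complex V).

Let weak_openT : weak_open [set: geom R K].
Proof. by move=> s _ x _ _; exists 1. Qed.

Let weak_openI : setI_closed (@weak_open R V K).
Proof.
move=> A B oA oB s Ks x sx [Ax Bx].
have [e e0 eA] := oA s Ks x sx Ax; have [f f0 fB] := oB s Ks x sx Bx.
exists (Num.min e f); first by rewrite lt_min e0.
move=> y sy xy; split; [apply: eA|apply: fB] => // v /xy;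
  by rewrite lt_min => /andP[].
Qed.

Let weak_open_bigU (I : Type) (f : I -> set (geom R K)) :
  (forall i, weak_open (f i)) -> weak_open (\bigcup_i f i).
Proof.
move=> of_ s Ks x sx [i _ fix_].
have [e e0 ef] := of_ i s Ks x sx fix_.
by exists e => // y sy xy; exists i => //; exact: ef.
Qed.

HB.instance Definition _ :=
  isOpenTopological.Build (geom R K) weak_openT weak_openI weak_open_bigU.

End WeakTopology.

Lemma open_geomE (R : realType) (V : choiceType) (K : complex V) :
  (open : set_system (geom R K)) = @weak_open R V K.
Proof. by []. Qed.

Lemma geom_incl_subproof (R : realType) (V : choiceType) (K L : complex V)
    (KL : faces K `<=` faces L) (x : geom R K) : `[< is_point L (bary x) >].
Proof. by apply/asboolP; have [? ? /KL] := geomP x. Qed.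

(* The inclusion of realizations induced by a subcomplex K of L. *)
Definition geom_incl (R : realType) (V : choiceType) (K L : complex V)
    (KL : faces K `<=` faces L) (x : geom R K) : geom R L :=
  Geom (geom_incl_subproof KL x).

(* Vertices (i, j) with i in Z_k; the copies are numbered by j = 0, 1, ... *)
Definition vertex (k : nat) : choiceType := ('Z_k * nat)%type.

Definition vshift (k : nat) (g : 'Z_k) (v : vertex k) : vertex k :=
  (g + v.1, v.2).

Record Zk_complex (k : nat) := ZkComplex {
  Zk_cplx :> complex (vertex k);
  Zk_inv : forall (g : 'Z_k) (s : {fset vertex k}),
    faces Zk_cplx s -> faces Zk_cplx (vshift g @` s)%fset }.

Lemma vshiftK (k : nat) (g : 'Z_k) : cancel (vshift g) (vshift (- g)).
Proof. by case=> i j; rewrite /vshift /= addKr. Qed.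

Lemma vshiftNK (k : nat) (g : 'Z_k) : cancel (vshift (- g)) (vshift g).
Proof. by case=> i j; rewrite /vshift /= addNKr. Qed.

Definition shift_bary (R : realType) (k : nat) (g : 'Z_k)
    (x : {fsfun vertex k -> R with 0}) : {fsfun vertex k -> R with 0} :=
  [fsfun v in (vshift g @` finsupp x)%fset => x (vshift (- g) v)].

Lemma shift_baryE (R : realType) (k : nat) (g : 'Z_k)
    (x : {fsfun vertex k -> R with 0}) v :
  shift_bary g x v = x (vshift (- g) v).
Proof.
rewrite /shift_bary fsfun_fun; case: ifPn => // vx.
rewrite fsfun_dflt//; apply: contra vx => vx.
by rewrite -[v](vshiftNK g) in_imfset.
Qed.

Lemma finsupp_shift (R : realType) (k : nat) (g : 'Z_k)
    (x : {fsfun vertex k -> R with 0}) :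
  finsupp (shift_bary g x) = (vshift g @` finsupp x)%fset.
Proof.
apply/fsetP => v; rewrite mem_finsupp shift_baryE -mem_finsupp.
apply/idP/imfsetP => /= [vx|[w wx ->]]; last by rewrite vshiftK.
by exists (vshift (- g) v) => //; rewrite vshiftNK.
Qed.

Lemma geom_act_subproof (R : realType) (k : nat) (K : Zk_complex k) (g : 'Z_k)
    (x : geom R K) : `[< is_point K (shift_bary g (bary x)) >].
Proof.
apply/asboolP; have [x0 x1 xK] := geomP x; split.
- by move=> v; rewrite shift_baryE.
- rewrite finsupp_shift big_imfset/=; last first.
    by move=> v w _ _; exact: (can_inj (vshiftK g)).
  by rewrite -[RHS]x1; apply: eq_bigr => v _; rewrite shift_baryE vshiftK.
- by rewrite finsupp_shift; exact: Zk_inv.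
Qed.

(* The simplicial action of Z_k on the realization by diagonal translation. *)
Definition geom_act (R : realType) (k : nat) (K : Zk_complex k) (g : 'Z_k)
    (x : geom R K) : geom R K :=
  Geom (geom_act_subproof g x).

Lemma geom_act0 (R : realType) (k : nat) (K : Zk_complex k) (x : geom R K) :
  geom_act 0 x = x.
Proof.
apply/val_inj/fsfunP => v /=.
by rewrite shift_baryE /vshift oppr0 add0r -surjective_pairing.
Qed.

Lemma geom_actD (R : realType) (k : nat) (K : Zk_complex k) (g h : 'Z_k)
    (x : geom R K) : geom_act (g + h) x = geom_act g (geom_act h x).
Proof.
apply/val_inj/fsfunP => v /=.
by rewrite !shift_baryE /vshift/= opprD addrCA addrA.
Qed.

Lemma geom_act_continuous (R : realType) (k : nat) (K : Zk_complex k) (g : 'Z_k) :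
  continuous (geom_act g : geom R K -> geom R K).
Proof.
apply/continuousP => U; rewrite open_geomE => oU s Ks x sx Ux.
have sub y : closed_simplex R K s y ->
    closed_simplex R K (vshift g @` s)%fset (geom_act g y).
  rewrite /closed_simplex /= finsupp_shift => /fsubsetP ys.
  by apply/fsubsetP => _ /imfsetP[v /= /ys vs ->]; rewrite in_imfset.
have [e e0 eU] := oU _ (Zk_inv g Ks) _ (sub _ sx) Ux.
exists e => // y sy xy; apply: eU; first exact: sub.
by move=> _ /imfsetP[v /= vs ->]; rewrite !shift_baryE vshiftK; exact: xy.
Qed.

(* The join (Z_k)^{*m}; for m <= n it is literally a subcomplex of (Z_k)^{*n}. *)
Definition join_faces (k m : nat) : set {fset vertex k} :=
  [set s | (forall v, v \in s -> (v.2 < m)%N) /\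
           (forall v w, v \in s -> w \in s -> v.2 = w.2 -> v = w)].

(* The simplex <i_1, ..., i_m>, where i_j is i`_(j - 1). *)
Definition facet (k : nat) (i : seq 'Z_k) : {fset vertex k} :=
  [fset ((i`_j, j) : vertex k) | j in iota 0 (size i)]%fset.

Definition jumps (k : nat) (i : seq 'Z_k) : nat :=
  (\sum_(j < (size i).-1) (i`_j != i`_j.+1)%R)%N.

Definition alt_faces (k m d : nat) : set {fset vertex k} :=
  [set s | exists2 i : m.-tuple 'Z_k,
             (jumps i <= d)%N & (s `<=` facet i)%fset].

Definition altN_faces (k d : nat) : set {fset vertex k} :=
  \bigcup_(m in [set m | (d < m)%N]) alt_faces m d.

Lemma join_faces_sub (k m : nat) (s t : {fset vertex k}) :
  (t `<=` s)%fset -> join_faces m s -> join_faces m t.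
Proof.
move=> /fsubsetP ts [s1 s2]; split=> [v /ts /s1 //|v w /ts vs /ts ws].
exact: s2.
Qed.

Lemma join_faces_inv (k m : nat) (g : 'Z_k) (s : {fset vertex k}) :
  join_faces m s -> join_faces m (vshift g @` s)%fset.
Proof.
move=> [s1 s2]; split=> [_ /imfsetP[v /= /s1 ? ->] //|].
move=> _ _ /imfsetP[v /= vs ->] /imfsetP[w /= ws ->] /= vw.
by rewrite (s2 v w).
Qed.

Lemma alt_faces_sub (k m d : nat) (s t : {fset vertex k}) :
  (t `<=` s)%fset -> alt_faces m d s -> alt_faces m d t.
Proof. by move=> ts [i di si]; exists i => //; exact: fsubset_trans si. Qed.

Lemma jumps_shift (k : nat) (g : 'Z_k) (i : seq 'Z_k) :
  jumps (map (fun a => g + a) i) = jumps i.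
Proof.
rewrite /jumps size_map; apply: eq_bigr => j _.
have ji : (j.+1 < size i)%N.
  by case: (size i) j => [[]//|n] j; rewrite ltnS (valP j).
by rewrite !(nth_map 0) ?(ltnW ji)// (inj_eq (addrI g)).
Qed.

Lemma alt_faces_inv (k m d : nat) (g : 'Z_k) (s : {fset vertex k}) :
  alt_faces m d s -> alt_faces m d (vshift g @` s)%fset.
Proof.
move=> [i di /fsubsetP si]; exists [tuple of map (fun a => g + a) i].
  by rewrite jumps_shift.
apply/fsubsetP => _ /imfsetP[v /= /si /imfsetP[j /= jm ->] ->].
apply/imfsetP; exists j; rewrite ?size_map//=.
by rewrite /vshift /= (nth_map 0)//; move: jm; rewrite mem_iota add0n.
Qed.

Lemma altN_faces_sub (k d : nat) (s t : {fset vertex k}) :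
  (t `<=` s)%fset -> altN_faces d s -> altN_faces d t.
Proof. by move=> ts [m dm ms]; exists m => //; exact: alt_faces_sub ms. Qed.

Lemma altN_faces_inv (k d : nat) (g : 'Z_k) (s : {fset vertex k}) :
  altN_faces d s -> altN_faces d (vshift g @` s)%fset.
Proof. by move=> [m dm ms]; exists m => //; exact: alt_faces_inv. Qed.

Definition Zk_join (k m : nat) : Zk_complex k :=
  @ZkComplex k (Complex (@join_faces_sub k m)) (@join_faces_inv k m).

Definition Zk_alt (k m d : nat) : Zk_complex k :=
  @ZkComplex k (Complex (@alt_faces_sub k m d)) (@alt_faces_inv k m d).

Definition Zk_altN (k d : nat) : Zk_complex k :=
  @ZkComplex k (Complex (@altN_faces_sub k d)) (@altN_faces_inv k d).

(* Facets are extended by repeating their last label. *)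
Lemma alt_mono (k d m n : nat) : (m <= n)%N ->
  faces (Zk_alt k m d) `<=` faces (Zk_alt k n d).
Proof.
move=> mn s [i di /fsubsetP si].
have sz : size (mkseq (fun j => i`_(minn j m.-1)) n) == n by rewrite size_mkseq.
exists (Tuple sz) => /=.
  apply: leq_trans di; rewrite /jumps size_mkseq size_tuple.
  rewrite -(big_mkord xpredT (fun j => (i`_j != i`_j.+1) : nat)).
  set f := mkseq _ _.
  rewrite -(big_mkord xpredT (fun j => (f`_j != f`_j.+1) : nat)).
  have mn1 : (m.-1 <= n.-1)%N by rewrite -!subn1 leq_sub2r.
  rewrite (@big_cat_nat _ _ _ m.-1)//= [X in (_ + X)%N]big_nat_cond.
  rewrite [X in (_ + X)%N]big1 ?addn0.
    rewrite !big_nat; apply: leq_sum => j /andP[_ jm].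
    have jn : (j.+1 < n)%N by rewrite -ltn_predRL (leq_trans jm).
    rewrite !nth_mkseq ?(ltnW jn)//.
    by rewrite (minn_idPl (ltnW jm)) (minn_idPl jm).
  move=> j /andP[/andP[mj jn] _].
  have jn' : (j.+1 < n)%N by rewrite -ltn_predRL.
  rewrite !nth_mkseq ?(ltnW jn')//.
  by rewrite (minn_idPr mj) (minn_idPr (leqW mj)) eqxx.
apply/fsubsetP => v /si /imfsetP[j /=]; rewrite mem_iota add0n size_tuple => jm ->.
apply/imfsetP; exists j => /=.
  by rewrite size_mkseq mem_iota add0n (leq_trans jm).
rewrite nth_mkseq ?(leq_trans jm)// (minn_idPl _)//.
by rewrite -ltnS (leq_trans jm)// leqSpred.
Qed.

Lemma alt_altN (k d m : nat) : (d < m)%N -> faces (Zk_alt k m d) `<=` faces (Zk_altN k d).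
Proof. by move=> dm s ms; exists m. Qed.

(* The inclusion f : A -> X of spaces with an action of G is a strong
   deformation retract, as G-spaces: H is a G-equivariant homotopy, relative
   to A, from the identity of X to a retraction r of X onto A. *)
Definition equivariant_strong_deformation_retract (R : realType) (G : Type)
    (A X : topologicalType) (aA : G -> A -> A) (aX : G -> X -> X)
    (f : A -> X) : Prop :=
  [/\ continuous f,
      forall g a, f (aA g a) = aX g (f a) &
      exists (r : X -> A) (H : X * R -> X),
        [/\ continuous r /\ cancel f r,
            {within [set: X] `*` `[0, 1], continuous H},
            forall x, H (x, 0) = x /\ H (x, 1) = f (r x),
            forall a t, t \in `[0, 1] -> H (f a, t) = f a &
            forall g x t, t \in `[0, 1] -> H (aX g x, t) = aX g (H (x, t))]].
Arguments equivariant_strong_deformation_retract R {G A X} aA aX f.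

(* Main.v *)
Require Import Defs.
From mathcomp Require Import all_boot all_order all_algebra finmap.
From mathcomp Require Import all_classical all_reals all_analysis.
From mathcomp Require Import zify.

(** The complex on [n + 1] positions collapses onto the complex on [n]
    positions as soon as [d < n], and the proof turns this collapse into an
    explicit flow.  Match each simplex that has a vertex at the last position
    [n] as follows: starting from [n] and going down, read the longest run of
    consecutive occupied positions whose successive labels all differ, say
    [n - r, ..., n], with label [i] at [n - r]; then add or delete the vertex
    [(i, n - r - 1)].  Position [n - r - 1] exists, because a run reaching
    position [0] would have [n > d] jumps, and adding the vertex creates no
    jump, because the position is empty or already has the label [i].

    The flow that realizes this matching takes mass at unit rate from every
    position of the run, called the rigid block, and gives it to the vertex
    [(i, n - r - 1)].  The block only shrinks: when one of its positions is
    exhausted, the run is cut just after it.  Hence the mass left after time [s]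
    has a closed formula ([step]) in terms of minima and sums of the initial
    masses, which makes continuity and equivariance immediate.  Along the flow
    position [j] only ever exchanges its label for the label of position
    [j + 1], and only when it is empty; the new labelling is thus the old one
    composed with a monotone map, which cannot create jumps
    ([njumps_monotone], [step_labels]).  The total mass is preserved because
    the losses and gains telescope ([step_mass], [block0]).  After time [1]
    position [n] is empty, and a point with no mass at [n] never moves.

    Performing these flows one after the other, from the highest position down
    to [m], deforms every larger complex onto the one on [m] positions.  The
    flow that empties position [m + c] runs during the interval from
    [1 / 2 ^ (c + 1)] to [1 / 2 ^ c] ([clock]), so that one formula serves the
    finite complexes and their infinite union alike: a given simplex is moved
    by finitely many steps only.  Joint continuity for the weak topology of the
    union, which is not locally finite, is reduced to closed simplices by a tube
    lemma ([geom_continuous]). *)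

Set Implicit Arguments.
Unset Strict Implicit.
Unset Printing Implicit Defensive.

Import Order.TTheory GRing.Theory Num.Theory.
Import numFieldNormedType.Exports.

Local Open Scope classical_set_scope.
Local Open Scope ring_scope.

(** * Simplices as labelled sets of positions *)

Section Labels.
Variable k : nat.
Implicit Types (I : nat -> 'Z_k) (s : {fset vertex k}).

Definition njumps (n : nat) I : nat := \sum_(j < n) (I j != I j.+1 : nat).

Lemma njumpsE n I : njumps n I = \sum_(0 <= j < n) (I j != I j.+1 : nat).
Proof. by rewrite big_mkord. Qed.

Lemma neq_jump a b I : (a <= b)%N ->
  ((I a != I b : nat) <= \sum_(a <= j < b) (I j != I j.+1 : nat))%N.
Proof.
elim: b => [|b IHb]; first by rewrite leqn0 => /eqP ->; rewrite eqxx.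
rewrite leq_eqVlt => /orP[/eqP ->|]; first by rewrite eqxx.
rewrite ltnS => ab; rewrite big_nat_recr//=.
apply: (@leq_trans ((I a != I b) + (I b != I b.+1))).
  by have [->|_] := eqVneq (I a) (I b); [rewrite add0n|case: (_ == _)].
by rewrite leq_add2r; exact: IHb.
Qed.

(** Jumps of the relabelling [I \o f] are charged to disjoint intervals of
    positions, namely those between successive values of [f]. *)
Lemma njumps_monotone n n' I (f : nat -> nat) :
  {homo f : a b / (a <= b)%N} -> (f n' <= n)%N ->
  (njumps n' (I \o f) <= njumps n I)%N.
Proof.
move=> fmono; rewrite !njumpsE => fn.
suff H : (\sum_(0 <= j < n') ((I \o f) j != (I \o f) j.+1 : nat) <=
          \sum_(0 <= j < f n') (I j != I j.+1 : nat))%N.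
  apply: leq_trans H _.
  by rewrite (@big_cat_nat _ _ _ (f n') 0 n)//= leq_addr.
elim: n' {fn} => [|n' IHn]; first by rewrite big_geq.
rewrite big_nat_recr//= (@big_cat_nat _ _ _ (f n') 0 (f n'.+1))//=; last exact: fmono.
by apply: leq_add => //; apply: neq_jump; exact: fmono.
Qed.

(** Labellings defined on all of [nat] can be composed with maps between
    positions, which tuples of fixed length cannot. *)
Lemma alt_facesP n d s : (0 < n)%N -> alt_faces n d s <->
  exists2 I : nat -> 'Z_k, (njumps n.-1 I <= d)%N &
    forall v, v \in s -> (v.2 < n)%N /\ v.1 = I v.2.
Proof.
move=> n0; split=> [[i di /fsubsetP si]|[I dI sI]].
  exists (fun j => i`_j).
    by move: di; rewrite /jumps size_tuple.
  move=> v /si /imfsetP[j /=]; rewrite mem_iota add0n size_tuple => jn ->.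
  by [].
have sz : size (mkseq I n) == n by rewrite size_mkseq.
exists (Tuple sz) => /=.
  rewrite /jumps size_mkseq; apply: leq_trans dI; apply: leq_sum => j _.
  have jn : (j.+1 < n)%N by rewrite -ltn_predRL.
  by rewrite !nth_mkseq// ltnW.
apply/fsubsetP => -[i j] /sI[/= jn ->]; apply/imfsetP; exists j => /=.
  by rewrite size_mkseq mem_iota.
by rewrite nth_mkseq.
Qed.

Lemma njumps_le n I : (njumps n I <= n)%N.
Proof.
rewrite /njumps; apply: (@leq_trans (\sum_(j < n) 1)); last by rewrite sum1_card card_ord.
by apply: leq_sum => j _; case: eqP.
Qed.

(** Among [d + 1] positions there is no room for more than [d] jumps. *)
Lemma join_faces_alt d : @join_faces k d.+1 = alt_faces d.+1 d.
Proof.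
apply/seteqP; split=> s.
  move=> [s1 s2]; apply/alt_facesP => //.
  have [I IP] : {I : nat -> 'Z_k & forall v, v \in s -> v.1 = I v.2}.
    pose P j i := ((i, j) : vertex k) \in s.
    exists (fun j => odflt 0 [pick i | P j i]) => -[i j] /= vs.
    case: pickP => [i' Pi'|/(_ i)]; last by rewrite /P vs.
    by have [] := s2 _ _ vs Pi' erefl.
  exists I => [|v vs]; first exact: njumps_le.
  by split; [exact: s1|exact: IP].
move=> /alt_facesP-/(_ erefl)[I _ IP]; split=> [v /IP[]//|[i j] [i' j']].
by move=> /IP[_ /= ->] /IP[_ /= ->] ->.
Qed.

End Labels.

(** * One collapsing flow *)

Section Step.
Variables (R : realType) (k n : nat).
Implicit Types (u : vertex k -> R) (s : R) (I : nat -> 'Z_k).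

Definition labelled I u := forall v, u v != 0 -> v.1 = I v.2.

(** The time, cut off at [s], during which the positions [n - q, ..., n] all
    belong to the rigid block and the label at [n - q] is [i].  At a point whose
    positions carry one label each, at most one term of the sum is nonzero. *)
Fixpoint block s u (q : nat) (i : 'Z_k) : R :=
  if q is p.+1 then
    Num.min (u (i, (n - q)%N)) (\sum_(i' | i' != i) block s u p i')
  else Num.min s (u (i, n)).

(** The masses after the flow has run for time [s].  The vertex [v] loses mass
    for as long as it belongs to the rigid block; it gains mass, from all the
    [q] positions after its own, for as long as the block starts at the next
    position with the label of [v].  The minimum is the time before that, when
    the block still contains another label at the position of [v].  For
    [q = 0] the value of [q.-1] is immaterial. *)
Definition step s u (v : vertex k) : R :=
  if (n < v.2)%N then u v else
  let q := (n - v.2)%N in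
  let b := block s u q.-1 v.1 in
  u v - block s u q v.1 +
  (b - Num.min b (\sum_(i | i != v.1) u (i, v.2))) *+ q.

Section Labelled.
Variables (I : nat -> 'Z_k) (u : vertex k -> R) (s : R).
Hypotheses (Iu : labelled I u) (u0 : forall v, 0 <= u v) (s0 : 0 <= s).

(* The mass of position [j] and the time that [j] spends in the rigid block. *)
Let w j := u (I j, j).
Let B j := block s u (n - j) (I j).

Lemma labelledE i j : u (i, j) = if i == I j then w j else 0.
Proof.
case: eqP => [->//|ne]; apply/eqP; apply: contraT => /Iu /= e.
by case: ne.
Qed.

Lemma block_ge0 q i : 0 <= block s u q i.
Proof.
elim: q i => [|q IHq] i /=; rewrite le_min ?s0 u0//=.
by rewrite sumr_ge0.
Qed.

Lemma block_off q i : i != I (n - q)%N -> block s u q i = 0.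
Proof.
move=> ne; apply: le_anti; rewrite block_ge0 andbT.
by case: q ne => [|q] /= ne; rewrite ge_min labelledE ?subn0 in ne *;
  rewrite (negbTE ne) lexx ?orbT.
Qed.

Lemma sum_neq (F : 'Z_k -> R) i i0 : (forall i', i' != i0 -> F i' = 0) ->
  \sum_(i' | i' != i) F i' = if i == i0 then 0 else F i0.
Proof.
move=> F0; case: eqVneq => [->|ne]; first by rewrite big1.
rewrite (bigD1 i0)/= 1?eq_sym// big1 ?addr0// => i' /andP[_].
exact: F0.
Qed.

Lemma blockn : B n = Num.min s (w n).
Proof. by rewrite /B subnn. Qed.

Lemma block_rec j : (j < n)%N ->
  B j = if I j == I j.+1 then 0 else Num.min (w j) (B j.+1).
Proof.
move=> jn; rewrite /B.
have -> : (n - j)%N = (n - j.+1).+1 by rewrite -subSn.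
rewrite /= (_ : (n - (n - j.+1).+1)%N = j); last by lia.
rewrite (@sum_neq _ _ (I j.+1)); last first.
  by move=> i' ne; rewrite block_off// subKn.
by case: ifP => _ //; rewrite min_r.
Qed.

Lemma block_incr j : (j < n)%N -> B j <= B j.+1.
Proof.
move=> jn; rewrite block_rec//; case: ifP => _; first exact: block_ge0.
by rewrite ge_min lexx orbT.
Qed.

Lemma block_le j : (j <= n)%N -> B j <= w j.
Proof.
rewrite leq_eqVlt => /orP[/eqP ->|jn]; first by rewrite blockn ge_min lexx orbT.
rewrite block_rec//; case: ifP => _; first exact: u0.
by rewrite ge_min lexx.
Qed.

Lemma step_top i : step s u (i, n) = if i == I n then w n - B n else 0.
Proof.
rewrite /step /= ltnn subnn mulr0n addr0 labelledE.
case: eqP => [->|/eqP ne]; first by rewrite /B subnn.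
by rewrite block_off ?subn0// subr0.
Qed.

Lemma step_lt i j : (j < n)%N -> step s u (i, j) =
  (if i == I j then w j - B j else 0) +
  (if i == I j.+1 then (B j.+1 - B j) *+ (n - j) else 0).
Proof.
move=> jn; rewrite /step /= ltnNge (ltnW jn)/=; congr (_ + _).
  rewrite labelledE; case: eqP => [->//|/eqP ne].
  by rewrite block_off ?subr0// subKn// ltnW.
have -> : (n - j).-1 = (n - j.+1)%N by rewrite subnS.
case: eqP => [->|/eqP ne]; last first.
  rewrite block_off ?subKn// min_l ?subr0 ?mul0rn//.
  by apply: sumr_ge0 => i' _; exact: u0.
rewrite -/(B j.+1) (@sum_neq _ _ (I j)); last first.
  by move=> i' ne; rewrite labelledE (negbTE ne).
rewrite [B j]block_rec// eq_sym; case: ifP => _; last by rewrite minC.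
by rewrite min_r//; exact: block_ge0.
Qed.

Lemma step_gt v : (n < v.2)%N -> step s u v = u v.
Proof. by rewrite /step => ->. Qed.

Lemma step_ge0 v : 0 <= step s u v.
Proof.
case: v => i j; case: (ltngtP n j) => [nj|jn|<-]; first by rewrite step_gt.
- rewrite step_lt//; apply: addr_ge0; case: ifP => // _.
    by rewrite subr_ge0 block_le// ltnW.
  by rewrite mulrn_wge0// subr_ge0 block_incr.
- by rewrite step_top; case: ifP => // _; rewrite subr_ge0 block_le.
Qed.

(** In the rigid block the mass of position [j] drops by [B j] while position
    [j] receives [n - j] times [B j.+1 - B j] from the positions after it; the
    sum telescopes, and what is lost altogether is [n + 1] times [B 0]. *)
Lemma step_mass : B 0%N = 0 ->
  \sum_(j < n.+1) \sum_i step s u (i, nat_of_ord j) =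
  \sum_(j < n.+1) \sum_i u (i, nat_of_ord j).
Proof.
have sum1 (F : R) i0 : \sum_(i : 'Z_k) (if i == i0 then F else 0) = F.
  by rewrite -big_mkcond big_pred1_eq.
move=> B0.
have -> : \sum_(j < n.+1) \sum_i u (i, nat_of_ord j) = \sum_(j < n.+1) w j.
  by apply: eq_bigr => j _; under eq_bigr do rewrite labelledE; exact: sum1.
rewrite [LHS]big_ord_recr [RHS]big_ord_recr/=.
under [X in _ + X]eq_bigr do rewrite step_top.
rewrite sum1.
have -> : \sum_(j < n) \sum_i step s u (i, nat_of_ord j) =
    \sum_(j < n) (w j + (B j.+1 *+ (n - j.+1).+1 - B j *+ (n - j).+1)).
  apply: eq_bigr => j _; under eq_bigr do rewrite step_lt//.
  rewrite big_split/= !sum1 -subSn// subSS.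
  by rewrite [B j *+ _.+1]mulrS opprD mulrnBl -addrA; congr (_ + _); rewrite addrCA.
rewrite big_split/= -(big_mkord xpredT
  (fun j => B j.+1 *+ (n - j.+1).+1 - B j *+ (n - j).+1)).
by rewrite telescope_sumr// subnn B0 mul0rn mulr1n subr0 -addrA [B n + _]addrC subrK.
Qed.

(** Position [j] takes the label of [j + 1] exactly when it gains mass, and then
    it has lost all the mass it had unless both labels agree.  The shift by at
    most one is monotone in [j], hence the bound on the jumps.  The case
    [N = n] describes the situation once position [n] is exhausted. *)
Lemma step_labels N d : (d < n)%N -> (N <= n.+1)%N ->
  (forall v, (N <= v.2)%N -> step s u v = 0) ->
  (forall v, (n < v.2)%N -> u v = 0) ->
  (njumps n I <= d)%N ->
  exists2 I' : nat -> 'Z_k, (njumps N.-1 I' <= d)%N &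
    forall v, step s u v != 0 -> (v.2 < N)%N /\ v.1 = I' v.2.
Proof.
move=> dn Nn stepN un dI.
pose f j := if (j < n)%N && (B j < B j.+1) then j.+1 else j.
have fmono : {homo f : a b / (a <= b)%N}.
  move=> a b; rewrite leq_eqVlt => /orP[/eqP->//|ab]; rewrite /f.
  by case: ifP; case: ifP; lia.
exists (I \o f).
  apply: leq_trans dI; apply: njumps_monotone => //.
  by rewrite /f; case: ifP; lia.
move=> [i j] nz; split=> /=.
  by rewrite ltnNge; apply: contra nz => Nj; apply/eqP; exact: stepN.
move: nz; rewrite /f; case: (ltngtP n j) => [nj|jn|<-] /=.
- by rewrite step_gt// un// eqxx.
- rewrite step_lt//; case: ltP => [BB|BB].
    case: (i =P I j.+1) => // ne; case: (i =P I j) => [e|]; last by rewrite addr0 eqxx.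
    move: BB; rewrite [B j]block_rec//.
    case: eqP => [e'|_]; first by case: ne; rewrite e.
    by case: (leP (w j)) => _; rewrite ?ltxx// subrr addr0 eqxx.
  have -> : B j.+1 = B j by apply: le_anti; rewrite BB block_incr.
  by rewrite subrr mul0rn; case: (i =P I j) => // _; rewrite if_same addr0 eqxx.
- by rewrite step_top; case: (i =P I n) => // _; rewrite eqxx.
Qed.

(** With fewer than [n] jumps on the positions [0, ..., n], two successive
    labels agree, and this stops the rigid block before position [0]. *)
Lemma block0 d : (d < n)%N -> (njumps n I <= d)%N -> B 0%N = 0.
Proof.
move=> dn dI.
have [j jn /eqP e] : exists2 j, (j < n)%N & I j == I j.+1.
  apply: contrapT => H; move: dI; rewrite leqNgt => /negP; apply.
  rewrite /njumps (eq_bigr (fun=> 1%N)); first by rewrite sum1_card card_ord.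
  move=> j _; case: eqP => // e; exfalso; apply: H.
  by exists (nat_of_ord j); rewrite ?ltn_ord// e.
have Bj : B j = 0 by rewrite block_rec// e eqxx.
apply: le_anti; rewrite block_ge0 andbT -Bj.
elim: j jn {e Bj} => // j IHj jn.
by apply: le_trans (block_incr _); [apply: IHj|]; exact: ltnW.
Qed.

End Labelled.

Lemma block_id s u : (forall v, 0 <= u v) ->
  (forall i, Num.min s (u (i, n)) = 0) -> forall q i, block s u q i = 0.
Proof.
move=> u0 b0; elim=> [|q IHq] i //=.
by rewrite big1 ?min_r.
Qed.

Lemma step_id s u : (forall v, 0 <= u v) ->
  (forall i, Num.min s (u (i, n)) = 0) -> step s u =1 u.
Proof.
move=> u0 b0 v; rewrite /step; case: ifP => // _.
rewrite !block_id// subr0 min_l ?subr0 ?mul0rn ?addr0//.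
exact: sumr_ge0.
Qed.

Lemma block_shift s u (g : 'Z_k) q i :
  block s (u \o vshift g) q i = block s u q (g + i).
Proof.
elim: q i => [//|q IHq] i /=; congr Num.min.
rewrite [RHS](reindex_inj (addrI g))/=.
by apply: eq_big => [i'|i' _]; rewrite ?(inj_eq (addrI g)).
Qed.

Lemma step_shift s u (g : 'Z_k) :
  step s (u \o vshift g) =1 step s u \o vshift g.
Proof.
move=> [i j]; rewrite /step /vshift /=; case: ifP => // _.
rewrite !block_shift.
have -> // : \sum_(i' | i' != i) (u \o vshift g) (i', j) =
             \sum_(i' | i' != g + i) u (i', j).
rewrite [RHS](reindex_inj (addrI g))/=.
by apply: eq_bigl => i'; rewrite (inj_eq (addrI g)).
Qed.

End Step.

(** * Composing the collapses *)

Section Flow.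
Variables (R : realType) (k : nat).
Implicit Types (u : vertex k -> R) (s t : R) (n m c d : nat).

(** The points of the complex on [n] positions, as plain functions: the flow is
    given by formulas in the masses, and its support is known only afterwards. *)
Definition alt_point n d u : Prop :=
  [/\ forall v, 0 <= u v,
      \sum_(j < n) \sum_i u (i, nat_of_ord j) = 1 &
      exists2 I : nat -> 'Z_k, (njumps n.-1 I <= d)%N &
        forall v, u v != 0 -> (v.2 < n)%N /\ v.1 = I v.2].

Lemma alt_point_out n d u v : alt_point n d u -> (n <= v.2)%N -> u v = 0.
Proof.
move=> [_ _ [I _ uI]]; rewrite leqNgt => vn.
by apply/eqP; apply: contraNT vn => /uI[].
Qed.

Lemma mass_widen n n' u : (n <= n')%N ->
  (forall v, (n <= v.2)%N -> u v = 0) ->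
  \sum_(j < n') \sum_i u (i, nat_of_ord j) =
  \sum_(j < n) \sum_i u (i, nat_of_ord j).
Proof.
move=> nn' un; rewrite -!(big_mkord xpredT (fun j => \sum_i u (i, j))).
rewrite (@big_cat_nat _ _ _ n)//= [X in _ + X]big_nat_cond [X in _ + X]big1 ?addr0//.
by move=> j /andP[/andP[nj _] _]; rewrite big1// => i _; rewrite un.
Qed.

Lemma alt_point_mono n n' d u : (0 < n)%N -> (n <= n')%N ->
  alt_point n d u -> alt_point n' d u.
Proof.
move=> n0 nn' nu; have un v := @alt_point_out n d u v nu.
case: nu => u0 u1 [I dI uI]; split=> //; first by rewrite (mass_widen nn').
exists (I \o minn n.-1); last first.
  move=> v /uI[vn ->]; split; first exact: leq_trans nn'.
  by rewrite /= (minn_idPr _)// -ltnS prednK.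
apply: leq_trans dI; apply: njumps_monotone; last by rewrite geq_minl.
by move=> a b ab; rewrite leq_min geq_minl/= geq_min ab orbT.
Qed.

Lemma alt_point_le1 n d u v : alt_point n d u -> u v <= 1.
Proof.
move=> nu; case: (ltnP v.2 n) => [vn|nv]; last by rewrite (alt_point_out nu nv).
case: nu => u0 <- _; rewrite (bigD1 (Ordinal vn))//= (bigD1 v.1)//=.
rewrite -surjective_pairing -addrA lerDl addr_ge0//; apply: sumr_ge0 => // j _.
exact: sumr_ge0.
Qed.

(** Both cases matter: [N = n + 1] at any time, and [N = n] at time [1], when
    position [n] has been emptied. *)
Lemma step_alt_point N n d s u : (d < n)%N -> 0 <= s -> (N <= n.+1)%N ->
  alt_point n.+1 d u -> (forall v, (N <= v.2)%N -> step n s u v = 0) ->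
  alt_point N d (step n s u).
Proof.
move=> dn s0 Nn nu stepN; have un v := @alt_point_out n.+1 d u v nu.
case: nu => u0 u1 [I dI uI].
have Iu : labelled I u by move=> v /uI[].
split; first exact: (step_ge0 _ Iu).
  rewrite -(mass_widen Nn)// (step_mass Iu)//; exact: (block0 Iu u0 s0 dn dI).
exact: (step_labels Iu u0 s0 dn Nn stepN un dI).
Qed.

Lemma step_point n d s u : (d < n)%N -> 0 <= s ->
  alt_point n.+1 d u -> alt_point n.+1 d (step n s u).
Proof.
move=> dn s0 nu; apply: step_alt_point => // v nv.
by rewrite step_gt// (alt_point_out nu).
Qed.

Lemma step_collapse n d u : (d < n)%N ->
  alt_point n.+1 d u -> alt_point n d (step n 1 u).
Proof.
move=> dn nu; apply: step_alt_point => // -[i j] /=.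
rewrite leq_eqVlt => /orP[/eqP <-|nj]; last by rewrite step_gt// (alt_point_out nu).
have [u0 _ [I _ uI]] := nu; have Iu : labelled I u by move=> v /uI[].
rewrite (step_top _ Iu)//; case: eqP => // _.
by rewrite blockn min_r ?subrr//; exact: alt_point_le1 nu.
Qed.

(** The step [c] of the composite takes place for [t] between [1 / 2 ^ (c + 1)]
    and [1 / 2 ^ c]: the step [c] starts only when the step [c + 1] is over,
    which leaves room for infinitely many steps. *)
Definition clock c t : R := Num.min 1 (Num.max 0 (2 ^+ c.+1 * t - 1)).

Lemma clock_ge0 c t : 0 <= clock c t.
Proof. by rewrite /clock le_min ler01 le_max lexx. Qed.

Lemma clock0 c : clock c 0 = 0.
Proof. by rewrite /clock mulr0 sub0r max_l ?min_r// oppr_le0. Qed.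

Lemma clock1 c : clock c 1 = 1.
Proof.
rewrite /clock mulr1 min_l// le_max; apply/orP; right.
by rewrite lerBrDr exprS ler_peMr ?exprn_ege1 ?ler1n.
Qed.

Lemma clock_seq c c' t : (c' < c)%N -> clock c t = 1 \/ clock c' t = 0.
Proof.
move=> cc'; have [t1|t1] := leP 2 (2 ^+ c.+1 * t); [left|right].
  by rewrite /clock min_l// le_max lerBrDr [1 + 1](_ : _ = 2)// t1 orbT.
rewrite /clock max_l ?min_r//= subr_le0.
have [t0|t0] := leP t 0.
  by apply: le_trans ler01; rewrite mulr_ge0_le0// exprn_ge0.
have : 2 ^+ c'.+2 * t < 2.
  by apply: le_lt_trans t1; rewrite ler_pM2r// ler_weXn2l ?ler1n.
by rewrite exprS -mulrA -[X in _ < X]mulr1 ltr_pM2l// => /ltW.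
Qed.

(** Positions [m + c - 1, ..., m] are emptied in this order. *)
Fixpoint flow m t c u : vertex k -> R :=
  if c is c'.+1 then flow m t c' (step (m + c') (clock c' t) u) else u.

Lemma flow_id m t c u : (forall v, 0 <= u v) ->
  (forall c', (c' < c)%N -> clock c' t = 0) -> flow m t c u = u.
Proof.
move=> u0; elim: c => //= c IHc t0; rewrite t0//.
have -> : step (m + c) 0 u = u by apply/funext/step_id => // i; rewrite min_l.
by apply: IHc => c' cc'; exact/t0/ltnW.
Qed.

Lemma flow_at0 m c u : (forall v, 0 <= u v) -> flow m 0 c u = u.
Proof. by move=> u0; apply: flow_id => // c' _; exact: clock0. Qed.

(** A step that empties an empty position does nothing. *)
Lemma flow_stable m t c c' u : (forall v, 0 <= u v) -> (c <= c')%N ->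
  (forall v, (m + c <= v.2)%N -> u v = 0) -> flow m t c' u = flow m t c u.
Proof.
move=> u0 /subnKC <- uc; elim: (c' - c)%N => {c'}[|e IHe]; first by rewrite addn0.
rewrite addnS /= -[RHS]IHe; congr flow; apply/funext/step_id => // i.
by rewrite uc ?min_r ?clock_ge0//= leq_add2l leq_addr.
Qed.

(** At any time at most one step is under way: if the step [c] is over, its
    result lies in the complex on [m + c] positions and the induction goes on;
    if it is not, the lower steps have not started and act as the identity. *)
Lemma flow_point m d t c u : (d < m)%N ->
  alt_point (m + c) d u -> alt_point (m + c) d (flow m t c u).
Proof.
move=> dm; elim: c u => [//|c IHc] u; rewrite addnS => cu.
have dmc : (d < m + c)%N by apply: leq_trans dm _; exact: leq_addr.
have stu := step_point dmc (clock_ge0 c t) cu.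
have [t1|t0] : clock c t = 1 \/ forall c', (c' < c)%N -> clock c' t = 0.
- case: (pselect (clock c t = 1)) => [|nt1]; [by left|right] => c' cc'.
  by case: (clock_seq t cc').
- apply: (@alt_point_mono (m + c)) => //; first exact: leq_ltn_trans dmc.
  by rewrite /= t1; apply: IHc; exact: step_collapse.
- by rewrite /= flow_id//; case: stu.
Qed.

Lemma flow_collapse m d c u : (d < m)%N ->
  alt_point (m + c) d u -> alt_point m d (flow m 1 c u).
Proof.
move=> dm; elim: c u => [|c IHc] u; first by rewrite addn0.
rewrite addnS => cu; apply: IHc; rewrite clock1; apply: step_collapse => //.
by apply: leq_trans dm _; exact: leq_addr.
Qed.

Lemma flow_shift m t c u (g : 'Z_k) :
  flow m t c (u \o vshift g) = flow m t c u \o vshift g.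
Proof.
elim: c u => [//|c IHc] u /=; rewrite -IHc; congr flow.
exact/funext/step_shift.
Qed.

(** ** Continuity in the masses and in time *)

Section Convergence.
Variables (T : Type) (F : set_system T) (FF : Filter F).

Lemma min_cvg (f g : T -> R) (a b : R) : f @ F --> a -> g @ F --> b ->
  (fun x => Num.min (f x) (g x)) @ F --> Num.min a b.
Proof.
move=> fa gb.
apply: (@continuous2_cvg _ _ _ _ _ _ f g (fun x y => Num.min x y) a b) => //.
exact: (@min_continuous _ R (a, b)).
Qed.

Lemma max_cvg (f g : T -> R) (a b : R) : f @ F --> a -> g @ F --> b ->
  (fun x => Num.max (f x) (g x)) @ F --> Num.max a b.
Proof.
move=> fa gb.
apply: (@continuous2_cvg _ _ _ _ _ _ f g (fun x y => Num.max x y) a b) => //.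
exact: (@max_continuous _ R (a, b)).
Qed.

Lemma sum_cvg (I : Type) (r : seq I) (P : pred I) (f : I -> T -> R) (a : I -> R) :
  (forall i, f i @ F --> a i) ->
  (fun x => \sum_(i <- r | P i) f i x) @ F --> \sum_(i <- r | P i) a i.
Proof.
move=> fa; elim: r => [|i r IHr].
  by rewrite big_nil; under eq_fun do rewrite big_nil; exact: cvg_cst.
rewrite big_cons; under eq_fun do rewrite big_cons.
by case: ifP => _ //; apply: cvgD.
Qed.

Lemma block_cvg n (S : T -> R) (U : T -> vertex k -> R) s u q i : S @ F --> s ->
  (forall v, U x v @[x --> F] --> u v) ->
  block n (S x) (U x) q i @[x --> F] --> block n s u q i.
Proof.
move=> Ss Uu; elim: q i => [|q IHq] i /=; apply: min_cvg => //.
exact: sum_cvg.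
Qed.

Lemma step_cvg n (S : T -> R) (U : T -> vertex k -> R) s u v : S @ F --> s ->
  (forall v, U x v @[x --> F] --> u v) ->
  step n (S x) (U x) v @[x --> F] --> step n s u v.
Proof.
move=> Ss Uu; rewrite /step; case: ifP => [_|_]; first exact: Uu.
have bc q : block n (S x) (U x) q v.1 @[x --> F] --> block n s u q v.1.
  exact: block_cvg.
apply: cvgD; first exact: cvgB.
apply: cvgMn; apply: cvgB => //; apply: min_cvg => //.
by apply: sum_cvg => i; exact: Uu.
Qed.

Lemma clock_cvg c (S : T -> R) t : S @ F --> t ->
  clock c (S x) @[x --> F] --> clock c t.
Proof.
move=> St; apply: min_cvg; first exact: cvg_cst.
apply: max_cvg; first exact: cvg_cst.
by apply: cvgB; [apply: cvgMr|exact: cvg_cst].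
Qed.

Lemma flow_cvg m c (S : T -> R) (U : T -> vertex k -> R) t u v : S @ F --> t ->
  (forall v, U x v @[x --> F] --> u v) ->
  flow m (S x) c (U x) v @[x --> F] --> flow m t c u v.
Proof.
move=> St; elim: c U u v => [|c IHc] U u v Uu /=; first exact: Uu.
apply: IHc => w; apply: step_cvg => //; exact: clock_cvg.
Qed.

End Convergence.

End Flow.

(** * Maps between realizations *)

Section WeakContinuity.
Variable R : realType.

Section SimplexFilter.
Variables (V : choiceType) (K : complex V).
Implicit Types (s : {fset V}) (x y : geom R K).

(** The Euclidean neighbourhoods of [x] within the closed simplex [s].  As
    filters on the whole realization, they let the convergence lemmas for real
    functions be used on each simplex. *)
Definition simplex_nbhs s x : set_system (geom R K) :=
  filter_from [set e : R | 0 < e] (fun e =>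
    [set y | closed_simplex R K s y /\
             forall v, v \in s -> `|bary x v - bary y v| < e]).

Global Instance simplex_nbhs_filter s x : Filter (simplex_nbhs s x).
Proof.
apply: filter_from_filter; first by exists 1 => /=.
move=> e f e0 f0; exists (Num.min e f) => /=; first by rewrite lt_min e0.
by move=> y [sy xy]; split; split=> // v /xy; rewrite lt_min => /andP[].
Qed.

Lemma open_simplexP (U : set (geom R K)) : open U <->
  forall s x, faces K s -> closed_simplex R K s x -> U x ->
    \forall y \near simplex_nbhs s x, U y.
Proof.
rewrite open_geomE; split=> [oU s x Ks sx Ux|oU s Ks x sx Ux].
  have [e e0 eU] := oU _ Ks _ sx Ux.
  by exists e => // y [sy xy]; exact: eU.
have [e e0 eU] := oU _ _ Ks sx Ux.
by exists e => // y sy xy; apply: eU.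
Qed.

Lemma simplex_nbhs_in s x : \forall y \near simplex_nbhs s x, closed_simplex R K s y.
Proof. by exists 1 => /=[|y []]. Qed.

Lemma bary_cvg s x v : closed_simplex R K s x ->
  bary y v @[y --> simplex_nbhs s x] --> bary x v.
Proof.
move=> sx; apply/cvgrPdist_lt => e e0; exists e => //= y [sy xy].
have [vs|vs] := boolP (v \in s); first exact: xy.
have out z : closed_simplex R K s z -> bary z v = 0.
  by move=> /fsubsetP zs; rewrite fsfun_dflt//; apply: contra vs => /zs.
by rewrite !out// subrr normr0.
Qed.

(** On the finitely many simplices with vertices in a finite set, the weak
    topology is the topology of coordinatewise convergence: the support of a
    nearby point contains that of the limit [z], so both points lie in one of
    finitely many closed simplices around [z]. *)
Lemma bary_cvg_open (T : Type) (F : set_system T) (Z : T -> geom R K)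
    (z : geom R K) (S : {fset V}) (U : set (geom R K)) : Filter F ->
  (\forall p \near F, (finsupp (bary (Z p)) `<=` S)%fset) ->
  (forall v, bary (Z p) v @[p --> F] --> bary z v) ->
  open U -> U z -> \forall p \near F, U (Z p).
Proof.
move=> FF ZS Zz oU Uz.
suff : \forall p \near F, forall s, s \in fpowerset S ->
    finsupp (bary (Z p)) = s -> U (Z p).
  move: ZS; apply: filterS2 => p pS; apply; last by [].
  by rewrite fpowersetE.
apply: (@filterS _ F _ (\bigcap_(s in [set` fpowerset S])
  [set p | finsupp (bary (Z p)) = s -> U (Z p)])) => [p + s sS|]; first exact.
apply: filter_bigI => s _.
have [Ks|nKs] := pselect (faces K s); last first.
  by apply: nearW => p /= ps; have [_ _] := geomP (Z p); rewrite ps.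
have [zs|/fsubsetPn[v vz vs]] := boolP (finsupp (bary z) `<=` s)%fset.
  have [e /= e0 eU] := (open_simplexP U).1 oU s z Ks zs Uz.
  have : \forall p \near F, forall v, v \in s -> `|bary z v - bary (Z p) v| < e.
    apply: (@filterS _ F _ (\bigcap_(v in [set` s])
      [set p | `|bary z v - bary (Z p) v| < e])) => [p + v vs|]; first exact.
    by apply: filter_bigI => v _; apply: cvgr_dist_lt.
  apply: filterS => p pe /= ps; apply: eU; split=> //.
  by rewrite /closed_simplex /= ps fsubset_refl.
have z0 : 0 < `|bary z v| by rewrite normr_gt0 -mem_finsupp.
have : \forall p \near F, `|bary z v - bary (Z p) v| < `|bary z v|.
  exact: cvgr_dist_lt.
apply: filterS => p /= pv ps; exfalso; move: pv.
by rewrite (_ : bary (Z p) v = 0) ?subr0 ?ltxx// fsfun_dflt// ps.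
Qed.

End SimplexFilter.

(** Continuity on [geom R K * R] can be tested on the products of the closed
    simplices with [R], although [K] need not be locally finite: by the tube
    lemma for a compact neighbourhood [C] of [t], the points [x] such that
    [{x} * C] is sent into a given open set form a weakly open set. *)
Lemma geom_continuous (V W : choiceType) (K : complex V) (L : complex W)
    (H : geom R K * R -> geom R L) :
  (forall s, faces K s -> exists S : {fset W},
     forall y t, closed_simplex R K s y -> (finsupp (bary (H (y, t))) `<=` S)%fset) ->
  (forall s x t v, faces K s -> closed_simplex R K s x ->
     bary (H p) v @[p --> filter_prod (simplex_nbhs s x) (nbhs t)] -->
     bary (H (x, t)) v) ->
  continuous H.
Proof.
move=> HS Hcvg [x0 t0] U0; rewrite nbhsE => -[U [oU UH] UU0].
apply: filterS UU0 _ => {U0}.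
have near_pt s x t : faces K s -> closed_simplex R K s x -> U (H (x, t)) ->
    \forall p \near filter_prod (simplex_nbhs s x) (nbhs t), U (H p).
  move=> Ks sx Uxt; have [S sS] := HS s Ks.
  apply: (@bary_cvg_open _ L _ _ H (H (x, t)) S U) => // [|v]; last exact: Hcvg.
  exists ([set y | closed_simplex R K s y], setT) => /=.
    by split; [exact: simplex_nbhs_in|exact: filterT].
  by move=> [y t'] /= [sy _]; exact: sS.
have x0x0 : closed_simplex R K (finsupp (bary x0)) x0 by exact: fsubset_refl.
have [_ _ Kx0] := geomP x0.
have [[P Q] /= [Px0 Qt0] PQ] := near_pt _ _ _ Kx0 x0x0 UH.
have [d /= d0 dQ] : exists2 d : R, 0 < d & forall t, `|t0 - t| <= d -> Q t.
  move/nbhs_ballP: Qt0 => [d /= d0 dQ]; exists (d / 2); first exact: divr_gt0.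
  move=> t td; apply: dQ; apply: le_lt_trans td _.
  by rewrite ltr_pdivrMr// mulr_natr mulr2n ltrDl.
pose C : set R := `[t0 - d, t0 + d]%classic.
have CE t : C t <-> `|t0 - t| <= d.
  by rewrite /C /= in_itv/= distrC ler_distl.
pose O := [set x | forall t, C t -> U (H (x, t))].
have oO : open O.
  apply/open_simplexP => s x Ks sx Ox.
  have /compact_near_coveringP cC : compact C by exact: segment_compact.
  apply: (cC _ _ (fun y t => U (H (y, t)))) => t Ct.
  have [[A B] /= [sA tB] AB] := near_pt _ _ _ Ks sx (Ox _ Ct).
  by exists (B, A) => //= -[t' y] /= [Bt' Ay]; exact: (AB (y, t')).
have Ox0 : O x0.
  move=> t /CE /dQ Qt; apply: (PQ (x0, t)); split => //=.
  by case: Px0 => e e0; apply; split=> // v _; rewrite subrr normr0.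
exists (O, ball t0 d) => /=.
  by split; [exact: open_nbhs_nbhs|exact: nbhsx_ballx].
by move=> [x t] /= [Ox td]; apply: Ox; apply/CE; exact: ltW.
Qed.

Lemma geom_continuous0 (V W : choiceType) (K : complex V) (L : complex W)
    (f : geom R K -> geom R L) :
  (forall s, faces K s -> exists S : {fset W},
     forall y, closed_simplex R K s y -> (finsupp (bary (f y)) `<=` S)%fset) ->
  (forall s x v, faces K s -> closed_simplex R K s x ->
     bary (f y) v @[y --> simplex_nbhs s x] --> bary (f x) v) ->
  continuous f.
Proof.
move=> fS fcvg.
have fc : continuous (fun p : geom R K * R => f p.1).
  apply: geom_continuous => [s /fS[S sS]|s x t v Ks sx].
    by exists S => y t /=; exact: sS.
  apply: (@cvg_comp _ _ _ fst (fun y => bary (f y) v)); first exact: cvg_fst.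
  exact: fcvg.
move=> x A fA; have [[P Q] /= [Px Q0] PQ] := fc (x, 0) A fA.
apply: filterS Px => y Py; apply: (PQ (y, 0)); split=> //=.
exact: nbhs_singleton.
Qed.

End WeakContinuity.

(** * Realizing the masses as points *)

Section AltPoints.
Variables (R : realType) (k : nat).
Implicit Types (u : vertex k -> R) (n d : nat).

Definition box n : {fset vertex k} :=
  [fset v in [seq ((i, j) : vertex k) | j <- iota 0 n, i <- index_enum 'Z_k]]%fset.

Lemma in_box n v : (v \in box n) = (v.2 < n)%N.
Proof.
rewrite inE /=; apply/allpairsP/idP => [[[j i] /= [+ _ ->]]|vn].
  by rewrite mem_iota.
by exists (v.2, v.1); rewrite /= mem_iota mem_index_enum -surjective_pairing.
Qed.

Lemma sum_box n u :
  \sum_(v <- box n) u v = \sum_(j < n) \sum_i u (i, nat_of_ord j).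
Proof.
rewrite -(big_mkord xpredT (fun j => \sum_i u (i, j))) /index_iota subn0.
rewrite -(big_allpairs_dep (J := vertex k) (h := fun j i => (i, j) : vertex k)).
apply: perm_big.
apply: uniq_perm; first exact: fset_uniq.
  apply: allpairs_uniq; [exact: iota_uniq|exact: index_enum_uniq|].
  by move=> [j i] [j' i'] _ _ /= [-> ->].
by move=> v; rewrite inE.
Qed.

Lemma sum_finsupp n (x : {fsfun vertex k -> R with 0}) :
  (finsupp x `<=` box n)%fset ->
  \sum_(v <- finsupp x) x v = \sum_(j < n) \sum_i x (i, nat_of_ord j).
Proof.
move=> xn; rewrite -sum_box; apply: big_fset_incl => // v _.
exact: fsfun_dflt.
Qed.

Definition fsfun_of n u : {fsfun vertex k -> R with 0} := [fsfun v in box n => u v].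

Lemma fsfun_ofE n u v : (forall v, (n <= v.2)%N -> u v = 0) -> fsfun_of n u v = u v.
Proof.
move=> un; rewrite fsfun_fun in_box; case: ltnP => // nv.
by rewrite un.
Qed.

Lemma alt_faces_box n d s : alt_faces n d s -> (s `<=` box n)%fset.
Proof.
move=> [i _ /fsubsetP si]; apply/fsubsetP => v /si /imfsetP[j /=].
by rewrite mem_iota size_tuple in_box => jn ->.
Qed.

Lemma geom_alt_point n d (K : complex (vertex k)) (x : geom R K) : (0 < n)%N ->
  alt_faces n d (finsupp (bary x)) -> alt_point n d (bary x).
Proof.
move=> n0 nx; have [x0 x1 _] := geomP x; split=> //.
  by rewrite -(sum_finsupp (alt_faces_box nx)).
have /(alt_facesP _ _ n0)[I dI xI] := nx.
by exists I => // v; rewrite -mem_finsupp; exact: xI.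
Qed.

Lemma alt_point_is_point n d u : (0 < n)%N ->
  alt_point n d u -> is_point (Zk_alt k n d) (fsfun_of n u).
Proof.
move=> n0 nu; have un v := @alt_point_out _ _ n d u v nu.
have fu v : fsfun_of n u v = u v by exact: fsfun_ofE.
have fbox : (finsupp (fsfun_of n u) `<=` box n)%fset.
  apply/fsubsetP => v; rewrite mem_finsupp fu in_box ltnNge.
  by apply: contra => nv; rewrite un.
case: nu => u0 u1 [I dI uI]; split.
- by move=> v; rewrite fu.
- rewrite (sum_finsupp fbox) -[RHS]u1.
  by apply: eq_bigr => j _; apply: eq_bigr => i _; rewrite fu.
- by apply/alt_facesP => //; exists I => // v; rewrite mem_finsupp fu; exact: uI.
Qed.

Lemma bary_act (K : Zk_complex k) (g : 'Z_k) (x : geom R K) :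
  bary (geom_act g x) = bary x \o vshift (- g) :> (vertex k -> R).
Proof. by apply/funext => v; rewrite /= shift_baryE. Qed.

Lemma bary_inj (K : complex (vertex k)) (x y : geom R K) :
  (forall v, bary x v = bary y v) -> x = y.
Proof. by move=> xy; apply/val_inj/fsfunP. Qed.

End AltPoints.

Lemma geom_incl_continuous (R : realType) (V : choiceType) (K L : complex V)
  (KL : faces K `<=` faces L) : continuous (geom_incl (R := R) KL).
Proof.
apply: geom_continuous0 => [s _|s x v _]; first by exists s.
exact: bary_cvg.
Qed.

(** * The deformation *)

Section Deformation.
Variables (R : realType) (k m d : nat) (dm : (d < m)%N) (K : Zk_complex k).
(* [K] stands for the complex on [n] positions as well as for the union. *)
Hypothesis mK : faces (Zk_alt k m d) `<=` faces K.
Hypothesis Kalt : forall s, faces K s -> exists n,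
  [/\ (m <= n)%N, alt_faces n d s & alt_faces n d `<=` faces K].

Let m0 : (0 < m)%N. Proof. exact: leq_ltn_trans dm. Qed.

Lemma level_exists (x : geom R K) : exists n, [/\ (m <= n)%N,
  alt_faces n d (finsupp (bary x)) & alt_faces n d `<=` faces K].
Proof. by have [_ _ /Kalt] := geomP x. Qed.

(** A number of positions sufficient for [x]; the choice is arbitrary and
    [mass_atE] below makes it irrelevant. *)
Definition level (x : geom R K) : nat := sval (cid (level_exists x)).

Lemma levelP x : [/\ (m <= level x)%N, alt_point (level x) d (bary x) &
  alt_faces (level x) d `<=` faces K].
Proof.
rewrite /level; case: cid => n /= [mn nx nK]; split=> //.
by apply: geom_alt_point => //; exact: leq_trans mn.
Qed.

Definition mass_at (t : R) (x : geom R K) : vertex k -> R :=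
  flow m t (level x - m) (bary x).

(** Any bound on the positions of [x] gives the same flow, so that one bound can
    be used for all points of a simplex, or for a point and its translates. *)
Lemma mass_atE t x n : (m <= n)%N -> (finsupp (bary x) `<=` box k n)%fset ->
  mass_at t x = flow m t (n - m) (bary x).
Proof.
move=> mn /fsubsetP xn; have [ml lx _] := levelP x.
have x0 v : 0 <= bary x v by case: lx.
have stable n' : (n' <= maxn (level x) n)%N -> (m <= n')%N ->
    (forall v, (n' <= v.2)%N -> bary x v = 0) ->
    flow m t (maxn (level x) n - m) (bary x) = flow m t (n' - m) (bary x).
  move=> n'n mn' xn'; apply: flow_stable; rewrite ?leq_sub2r//.
  by move=> v; rewrite subnKC//; exact: xn'.
rewrite /mass_at -(stable (level x)) ?leq_maxl//; last first.
  by move=> v; exact: alt_point_out lx.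
apply: stable; rewrite ?leq_maxr// => v; rewrite leqNgt => vn.
by apply: fsfun_dflt; apply: contra vn => /xn; rewrite in_box.
Qed.

Lemma mass_at_point t x : alt_point (level x) d (mass_at t x).
Proof.
have [ml + _] := levelP x; rewrite -{1 2}(subnKC ml).
exact: flow_point.
Qed.

Lemma mass_at1 x : alt_point m d (mass_at 1 x).
Proof.
have [ml + _] := levelP x; rewrite -{1}(subnKC ml).
exact: flow_collapse.
Qed.

Lemma homotopy_subproof (p : geom R K * R) :
  `[< is_point K (fsfun_of (level p.1) (mass_at p.2 p.1)) >].
Proof.
have [ml _ lK] := levelP p.1; apply/asboolP.
have l0 : (0 < level p.1)%N by exact: leq_trans ml.
by have [? ? /lK] := alt_point_is_point l0 (mass_at_point p.2 p.1).
Qed.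

Definition homotopy (p : geom R K * R) : geom R K := Geom (homotopy_subproof p).

Lemma retraction_subproof (x : geom R K) :
  `[< is_point (Zk_alt k m d) (fsfun_of m (mass_at 1 x)) >].
Proof. by apply/asboolP; apply: alt_point_is_point => //; exact: mass_at1. Qed.

Definition retraction (x : geom R K) : geom R (Zk_alt k m d) :=
  Geom (retraction_subproof x).

Lemma bary_homotopy x t v : bary (homotopy (x, t)) v = mass_at t x v.
Proof. by rewrite /= fsfun_ofE// => w; exact: alt_point_out (mass_at_point t x). Qed.

Lemma bary_retraction x v : bary (retraction x) v = mass_at 1 x v.
Proof. by rewrite /= fsfun_ofE// => w; exact: alt_point_out (mass_at1 x). Qed.

Lemma mass_at_cvg s x t v : faces K s -> closed_simplex R K s x ->
  mass_at p.2 p.1 v @[p --> filter_prod (simplex_nbhs s x) (nbhs t)] -->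
  mass_at t x v.
Proof.
move=> Ks sx; have [n [mn /alt_faces_box sn _]] := Kalt Ks.
have E y t' : closed_simplex R K s y -> mass_at t' y = flow m t' (n - m) (bary y).
  by move=> sy; apply: mass_atE => //; exact: fsubset_trans sn.
rewrite E//; apply: cvg_trans; last first.
  apply: (@flow_cvg _ _ _ (filter_prod (simplex_nbhs s x) (nbhs t)) _ m (n - m)
    snd (fun p => bary p.1)) => [|w]; first exact: cvg_snd.
  apply: (@cvg_comp _ _ _ fst (fun y => bary y w)); first exact: cvg_fst.
  exact: bary_cvg.
apply: near_eq_cvg; exists ([set y | closed_simplex R K s y], setT) => /=.
  by split; [exact: simplex_nbhs_in|exact: filterT].
by move=> [y t'] /= [sy _]; rewrite E.
Qed.

Lemma mass_at_supp s n x t v : closed_simplex R K s x -> (m <= n)%N ->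
  alt_faces n d s -> mass_at t x v != 0 -> (v.2 < n)%N.
Proof.
move=> sx mn ns; rewrite (mass_atE _ mn); last first.
  exact: fsubset_trans sx (alt_faces_box ns).
have nx : alt_point (m + (n - m)) d (bary x).
  rewrite subnKC//; apply: geom_alt_point; first exact: leq_trans mn.
  exact: alt_faces_sub ns.
rewrite ltnNge; apply: contra => nv; apply/eqP.
by apply: alt_point_out (flow_point t dm nx) _; rewrite subnKC.
Qed.

Lemma homotopy_continuous : continuous homotopy.
Proof.
apply: geom_continuous => [s /Kalt[n [mn ns _]]|s x t v Ks sx].
  exists (box k n) => y t sy; apply/fsubsetP => v.
  by rewrite mem_finsupp bary_homotopy in_box; exact: mass_at_supp ns.
rewrite bary_homotopy.
have -> : (fun p => bary (homotopy p) v) = (fun p => mass_at p.2 p.1 v).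
  by apply/funext => -[y t']; rewrite bary_homotopy.
exact: mass_at_cvg.
Qed.

Lemma retraction_continuous : continuous retraction.
Proof.
apply: geom_continuous0 => [s _|s x v Ks sx].
  exists (box k m) => y _; apply/fsubsetP => v.
  rewrite mem_finsupp bary_retraction in_box ltnNge; apply: contra => mv.
  by rewrite (alt_point_out (mass_at1 y)).
rewrite bary_retraction.
have -> : (fun y => bary (retraction y) v) = (fun y => mass_at 1 y v).
  by apply/funext => y; rewrite bary_retraction.
move=> A vA; have [[P Q] /= [Px Q1] PQ] := @mass_at_cvg s x 1 v Ks sx A vA.
by apply: filterS Px => y Py; apply: (PQ (y, 1)); split=> //; exact: nbhs_singleton.
Qed.

Lemma mass_at_incl t a : mass_at t (geom_incl mK a) = bary a.
Proof.
have [_ _ am] := geomP a.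
by rewrite (mass_atE _ (leqnn m)) ?subnn//; exact: alt_faces_box am.
Qed.

Lemma mass_at_act t g x v : mass_at t (geom_act g x) v = mass_at t x (vshift (- g) v).
Proof.
pose n := maxn (level (geom_act g x)) (level x).
have xn y : (level y <= n)%N -> (finsupp (bary y) `<=` box k n)%fset.
  move=> yn; apply/fsubsetP => w; rewrite mem_finsupp in_box ltnNge.
  apply: contra => nw; have [_ ly _] := levelP y.
  by rewrite (alt_point_out ly)// (leq_trans yn).
have mn : (m <= n)%N by have [ml _ _] := levelP x; rewrite leq_max ml orbT.
rewrite !(mass_atE _ mn); do ?by apply: xn; rewrite leq_max leqnn ?orbT.
by rewrite bary_act flow_shift.
Qed.

Lemma alt_deformation_retract : equivariant_strong_deformation_retract R
  (@geom_act R k (Zk_alt k m d)) (@geom_act R k K) (geom_incl (R := R) mK).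
Proof.
split; [exact: geom_incl_continuous|by move=> g a; exact: bary_inj|].
exists retraction, homotopy; split.
- split; first exact: retraction_continuous.
  by move=> a; apply: bary_inj => v; rewrite bary_retraction mass_at_incl.
- exact/continuous_subspaceT/homotopy_continuous.
- move=> x; split; apply: bary_inj => v; rewrite bary_homotopy.
    by rewrite /mass_at flow_at0//; have [] := geomP x.
  by rewrite -bary_retraction.
- by move=> a t _; apply: bary_inj => v; rewrite bary_homotopy mass_at_incl.
- move=> g x t _; apply: bary_inj => v.
  by rewrite bary_act /= -!/(homotopy _) !bary_homotopy mass_at_act.
Qed.

End Deformation.

Theorem theorem6p1 (R : realType) (k d : nat) (hk : (1 < k)%N) :
  [/\ faces (Zk_join k d.+1) = faces (Zk_alt k d.+1 d),
      forall (m n : nat) (dm : (d < m)%N) (mn : (m <= n)%N),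
        equivariant_strong_deformation_retract R
          (@geom_act R k (Zk_alt k m d)) (@geom_act R k (Zk_alt k n d))
          (geom_incl (R := R) (alt_mono (k := k) (d := d) mn)) &
      forall (m : nat) (dm : (d < m)%N),
        equivariant_strong_deformation_retract R
          (@geom_act R k (Zk_alt k m d)) (@geom_act R k (Zk_altN k d))
          (geom_incl (R := R) (alt_altN (k := k) dm))].
Proof.
split; first exact: join_faces_alt.
- move=> m n dm mn; apply: alt_deformation_retract => // s ns.
  by exists n; split.
- move=> m dm; apply: alt_deformation_retract => // s [n dn ns].
  (* A simplex on [n < m] positions is one on [m] positions. *)
  exists (maxn m n); split; first exact: leq_maxl.
    exact: alt_mono (leq_maxr m n) _ ns.
  by move=> t nt; exists (maxn m n) => //=; rewrite leq_max dm.
Qed.
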